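(* Suppose that $u_h=\sum_{i=1}^NU_i\varphi_i\in\mathcal{V}_h$ satisfies $u_{\min}\le\min_iU_i\le\max_iU_i\le u_{\max}$ for real numbers $u_{\min},u_{\max}$, and that the boundary values of $\mathcal{I}^W(u_h)$ are all computed from a given boundary function $u|_{\partial\Omega}$ with $u_{\min}\le u|_{\partial\Omega}\le u_{\max}$. Then the reconstructed continuous piecewise linear function $\mathcal{I}^W(u_h)\in\mathcal{W}_{h/2}$ preserves this bound on the whole domain: $$u_{\min}\le\mathcal{I}^W(u_h)\le u_{\max}\quad\text{on }\Omega .$$
   Context: $\mathcal{K}_h$ (the $h$-mesh) is a triangulation without hanging nodes of an open (bounded) polygonal domain $\Omega\subset\mathbb{R}^2$, and $\mathbf{x}_1,\dots,\mathbf{x}_N$ are the midpoints of all its edges. The Crouzeix-Raviart space $\mathcal{V}_h$ consists of functions that are affine on each triangle and whose jump across each interior edge has zero mean; its basis $\varphi_1,\dots,\varphi_N$ satisfies $\varphi_i(\mathbf{x}_j)=\delta_{ij}$. The $\frac h2$-mesh $\mathcal{K}_{h/2}$ is obtained by subdividing each triangle into four by connecting its edge midpoints. $\mathcal{W}_{h/2}$ is the space of continuous functions on $\Omega$ that are affine on each triangle of $\mathcal{K}_{h/2}$. Wachspress coordinates. For an $s$-sided convex polygon with vertices $\mathbf{y}_1,\dots,\mathbf{y}_s$ in cyclic order and a point $\mathbf{x}$ in its interior, $$w_i(\mathbf{x})=\frac{\tilde w_i(\mathbf{x})}{\sum_{j=1}^s\tilde w_j(\mathbf{x})},\qquad\tilde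 w_i(\mathbf{x})=\frac{\mathcal{A}(\mathbf{y}_{i-1},\mathbf{y}_i,\mathbf{y}_{i+1})}{\mathcal{A}(\mathbf{x},\mathbf{y}_{i-1},\mathbf{y}_i)\,\mathcal{A}(\mathbf{x},\mathbf{y}_i,\mathbf{y}_{i+1})},$$ where indices are cyclic and $\mathcal{A}(\mathbf{a},\mathbf{b},\mathbf{c})$ is the signed area of the triangle with vertices $\mathbf{a},\mathbf{b},\mathbf{c}$. These coordinates are nonnegative, sum to $1$, and reproduce affine functions. Reconstruction. For each interior vertex $\mathbf{y}_0$ of the $h$-mesh, its neighbours on the $\frac h2$-mesh are the midpoints $\mathbf{y}_1,\dots,\mathbf{y}_s$ of the edges of $\mathcal{K}_h$ emanating from $\mathbf{y}_0$; the polygon formed by connecting them in cyclic order around $\mathbf{y}_0$ is assumed to be convex. $\mathcal{I}^W(u_h)\in\mathcal{W}_{h/2}$ is defined by its values at the vertices of $\mathcal{K}_{h/2}$: at midpoints of interior edges of the $h$-mesh it equals $u_h$; at an interior vertex $\mathbf{y}_0$ of the $h$-mesh it equals $\sum_{j=1}^sw_j(\mathbf{y}_0)u_h(\mathbf{y}_j)$; and, under the convention of this statement, at all vertices of $\mathcal{K}_{h/2}$ lying on $\partial\Omega$ it takes the values of the given boundary function. *)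

(* Defs.v *)
From HB Require Import structures.
From mathcomp Require Import all_boot all_order all_algebra finmap.
From mathcomp Require Import all_classical all_reals all_analysis.

Set Implicit Arguments.
Unset Strict Implicit.
Unset Printing Implicit Defensive.

Import Order.TTheory GRing.Theory Num.Theory.
Import numFieldNormedType.Exports.

Local Open Scope fset_scope.
Local Open Scope classical_set_scope.
Local Open Scope ring_scope.

(* Triangles, and more generally finite point configurations, are represented
   by the finite set of their vertices; [hull] recovers the closed region. *)
Notation plane R := (R * R)%type.
Notation mesh R := {fset {fset plane R}}.

Definition hull (R : realType) (S : {fset plane R}) : set (plane R) :=
  [set x | exists l : plane R -> R,
    [/\ forall p, p \in S -> 0 <= l p,
        \sum_(p <- S) l p = 1
      & x = \sum_(p <- S) l p *: p]].

Definition signed_area (R : realType) (a b c : plane R) : R :=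
  ((b.1 - a.1) * (c.2 - a.2) - (c.1 - a.1) * (b.2 - a.2)) / 2.

Definition midpoint (R : realType) (a b : plane R) : plane R :=
  2^-1 *: (a + b).

Definition boundary (R : realType) (Omega : set (plane R)) : set (plane R) :=
  closure Omega `\` Omega.

Definition affine_on (R : realType) (A : set (plane R)) (f : plane R -> R) :=
  exists a b c : R, forall x, A x -> f x = a * x.1 + b * x.2 + c.

Definition is_triangle (R : realType) (T : {fset plane R}) :=
  exists a b c : plane R, T = [fset a; b; c] /\ signed_area a b c != 0.

(* [Omega = interior (closure Omega)] excludes slits, so that functions on the
   boundary are single valued; that the boundary is polygonal is part of
   [triangulation]. *)
Definition bounded_domain (R : realType) (Omega : set (plane R)) :=
  [/\ open Omega, Omega !=set0, connected Omega, bounded_set Omega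
    & Omega = interior (closure Omega)].

(* The third condition says that two closed triangles meet in their common
   vertices only, in a common edge, or not at all: no hanging nodes. *)
Definition triangulation (R : realType) (Omega : set (plane R)) (K : mesh R) :=
  [/\ forall T, T \in K -> is_triangle T,
      closure Omega = (\bigcup_(T in [set` K]) hull T)%classic
    & forall S T, S \in K -> T \in K ->
        hull S `&` hull T = hull (S `&` T)%fset].

Definition vertices (R : realType) (K : set {fset plane R}) : set (plane R) :=
  [set v | exists2 T, K T & v \in T].

(* An edge is given by its two endpoints. *)
Definition edge (R : realType) (K : mesh R) (a b : plane R) :=
  a != b /\ exists T, [/\ T \in K, a \in T & b \in T].

Definition interior_edge (R : realType) (Omega : set (plane R)) (K : mesh R)
    (a b : plane R) :=
  edge K a b /\ ~ hull [fset a; b] `<=` boundary Omega.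

Definition interior_vertex (R : realType) (Omega : set (plane R)) (K : mesh R)
    (v : plane R) :=
  vertices [set` K] v /\ Omega v.

Definition edge_midpoints (R : realType) (K : mesh R) : set (plane R) :=
  [set m | exists a b, edge K a b /\ m = midpoint a b].

(* The midpoints of the three edges of a triangle. *)
Definition medial (R : realType) (T : {fset plane R}) : {fset plane R} :=
  [fset midpoint a b | a in T, b in T & a != b].

(* The subtriangle of [T] at its vertex [a]: it contains [midpoint a a = a]. *)
Definition corner (R : realType) (T : {fset plane R}) (a : plane R)
    : {fset plane R} :=
  [fset midpoint a b | b in T].

Definition half_mesh (R : realType) (K : mesh R) : set {fset plane R} :=
  [set S | exists2 T, T \in K & S = medial T \/ exists2 a, a \in T & S = corner T a].

(* A function that may be discontinuous across edges is a family of functions,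
   one per triangle; [u T x] is only meaningful for [x] in [hull T]. *)
Definition piecewise (R : realType) := {fset plane R} -> plane R -> R.

Definition pw_eq (R : realType) (K : mesh R) (u v : piecewise R) :=
  forall T x, T \in K -> hull T x -> u T x = v T x.

Definition pw_comb (R : realType) (N : nat) (c : 'I_N -> R)
    (phi : 'I_N -> piecewise R) : piecewise R :=
  fun T x => \sum_i c i * phi i T x.

(* The jump is integrated over the constant-speed parametrization of the edge;
   the omitted factor, the length of the edge, does not affect vanishing. *)
Definition crouzeix_raviart (R : realType) (Omega : set (plane R)) (K : mesh R)
    (u : piecewise R) :=
  (forall T, T \in K -> affine_on (hull T) (u T)) /\
  (forall a b S T, interior_edge Omega K a b ->
    S \in K -> T \in K -> a \in S -> b \in S -> a \in T -> b \in T ->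
    \int[lebesgue_measure]_(t in `[0, 1])
      (u S ((1 - t) *: a + t *: b) - u T ((1 - t) *: a + t *: b)) = 0).

Definition crouzeix_raviart_basis (R : realType) (Omega : set (plane R))
    (K : mesh R) (N : nat) (x : 'I_N -> plane R) (phi : 'I_N -> piecewise R) :=
  [/\ forall i, crouzeix_raviart Omega K (phi i),
      forall u, crouzeix_raviart Omega K u ->
        exists! c : {ffun 'I_N -> R}, pw_eq K u (pw_comb c phi)
    & forall i j T, T \in K -> x j \in medial T -> phi i T (x j) = (i == j)%:R].

(* [W_{h/2}]; being affine on closed triangles, its elements are determined on
   the closure of the domain. *)
Definition half_mesh_space (R : realType) (Omega : set (plane R)) (K : mesh R)
    (w : plane R -> R) :=
  {within closure Omega, continuous w} /\
  (forall S, half_mesh K S -> affine_on (hull S) w).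

Definition wachspress_weight (R : realType) (s : nat) (y : 'I_s -> plane R)
    (x : plane R) (i : 'I_s) : R :=
  signed_area (y (ord_pred i)) (y i) (y (ordS i)) /
  (signed_area x (y (ord_pred i)) (y i) * signed_area x (y i) (y (ordS i))).

Definition wachspress (R : realType) (s : nat) (y : 'I_s -> plane R)
    (x : plane R) (i : 'I_s) : R :=
  wachspress_weight y x i / \sum_j wachspress_weight y x j.

Definition neighbours (R : realType) (K : mesh R) (v : plane R)
    : set (plane R) :=
  [set m | exists2 b, edge K v b & m = midpoint v b].

(* Counterclockwise cyclic order around [c], through polar coordinates centred
   at [c]. *)
Definition cyclic_around (R : realType) (s : nat) (c : plane R)
    (y : 'I_s -> plane R) :=
  exists r theta : 'I_s -> R,
    [/\ forall i, 0 < r i,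
        forall i j : 'I_s, (i < j)%N -> theta i < theta j,
        forall i j, theta i < theta j + 2 * pi
      & forall i, y i = c + r i *: (cos (theta i), sin (theta i))].

(* The closed region bounded by the polygon with vertices [y], when these are
   in cyclic order around [c], fewer than pi apart: it is star-shaped with
   respect to [c]. *)
Definition polygon (R : realType) (s : nat) (c : plane R) (y : 'I_s -> plane R)
    : set (plane R) :=
  (\bigcup_i hull [fset c; y i; y (ordS i)])%classic.

Definition convex_polygon (R : realType) (s : nat) (c : plane R)
    (y : 'I_s -> plane R) :=
  convex_set (polygon c y : set (convex_lmodType (plane R))).

(* [s v] and [y v] are the number and a cyclic enumeration of the neighbours of
   the interior vertex [v]. *)
Definition neighbour_enumeration (R : realType) (Omega : set (plane R))
    (K : mesh R) (s : plane R -> nat) (y : forall v, 'I_(s v) -> plane R) :=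
  forall v, interior_vertex Omega K v ->
    set_bij setT (neighbours K v) (y v) /\ cyclic_around v (y v).

(* [w] is the reconstruction of [u] with boundary values [g].  Since [u] lives
   on triangles, its value at the midpoint of an edge is read off from any
   triangle having this edge; for [u] in the Crouzeix-Raviart space and an
   interior edge all choices agree. *)
Definition wachspress_reconstruction (R : realType) (Omega : set (plane R))
    (K : mesh R) (s : plane R -> nat) (y : forall v, 'I_(s v) -> plane R)
    (u : piecewise R) (g w : plane R -> R) :=
  [/\ half_mesh_space Omega K w,
      forall a b T, interior_edge Omega K a b ->
        T \in K -> a \in T -> b \in T -> w (midpoint a b) = u T (midpoint a b),
      forall v, interior_vertex Omega K v ->
        forall T : 'I_(s v) -> {fset plane R},
          (forall j, T j \in K /\ y v j \in medial (T j)) ->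
          w v = \sum_j wachspress (y v) v j * u (T j) (y v j)
    & forall p, vertices (half_mesh K) p -> boundary Omega p -> w p = g p].

(* Main.v *)
Require Import Defs.
From mathcomp Require Import all_boot all_order all_algebra finmap.
From mathcomp Require Import all_classical all_reals all_analysis.
From mathcomp Require Import ring lra zify.
Import Order.TTheory GRing.Theory Num.Theory.
Import numFieldNormedType.Exports.
Local Open Scope classical_set_scope.
Local Open Scope ring_scope.

(** The reconstruction is affine on each triangle of the refined mesh, so its
    extreme values on the domain are attained at vertices of that mesh
    ([affine_on_hull_bounds], [half_mesh_cover]).  A vertex on the boundary of
    the domain carries a value of the boundary function, and the midpoint of an
    interior edge carries a coefficient [U i], because the Crouzeix-Raviart
    basis is nodal ([cr_midpoint_value]).  At an interior vertex [v] the value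
    is a combination of such coefficients, and the bound follows once the
    Wachspress coordinates of [v] are known to be nonnegative with sum 1
    ([wachspress_convex_weights]).

    That last point is where geometry enters, since the formula for the
    coordinates divides by areas and by the sum of the weights.  Three facts
    about the neighbours [y i] of [v], in cyclic order, settle it.
    - Each triangle [v, y i, y (ordS i)] is positively oriented.  As no triangle
      has [v] as a hanging node, the triangles having [v] as a vertex fill a
      neighbourhood of [v]; hence no open half plane through [v] is free of
      neighbours ([neighbour_in_direction]), and consecutive neighbours are
      less than [pi] apart ([consecutive_area_gt0]).
    - Each corner [y (ord_pred i), y i, y (ordS i)] turns to the left or is
      flat.  At a reflex corner the chord joining the two adjacent vertices
      would leave the polygon beyond [y i], against convexity
      ([convex_corner]).
    - Not all corners are flat: the one farthest from [v] is not
      ([farthest_corner]).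
    The first two make all weights nonnegative, the third makes their sum
    positive. *)

(** * Affine functions on convex hulls *)

Lemma plane_eq {R : realType} (p q : plane R) : p.1 = q.1 -> p.2 = q.2 -> p = q.
Proof. by case: p q => [? ?] [? ?] /= -> ->. Qed.

Lemma scale_real {R : realType} (k x : R) : k *: x = k * x.
Proof. by []. Qed.

(** Affine functions commute with barycentric combinations; the constant [c] is
    absorbed because the coefficients have sum 1. *)
Lemma affine_sum {R : realType} (a b c : R) (S : {fset plane R})
    (l : plane R -> R) : \sum_(p <- S) l p = 1 ->
  let x := \sum_(p <- S) l p *: p in
  a * x.1 + b * x.2 + c = \sum_(p <- S) l p * (a * p.1 + b * p.2 + c).
Proof.
move=> l1 x.
have -> : a * x.1 + b * x.2 + c =
    a * x.1 + b * x.2 + \sum_(p <- S) l p * c by rewrite -mulr_suml l1 mul1r.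
rewrite /x (big_morph (fun p : plane R => p.1) (id1 := 0) (op1 := +%R)) //.
rewrite (big_morph (fun p : plane R => p.2) (id1 := 0) (op1 := +%R)) //.
rewrite !mulr_sumr -!big_split /=.
by apply: eq_bigr => p _; rewrite !scale_real; ring.
Qed.

Lemma vertex_in_hull {R : realType} (S : {fset plane R}) (p : plane R) :
  p \in S -> hull S p.
Proof.
move=> pS; exists (fun u => (u == p)%:R); split.
- by move=> u _; rewrite ler0n.
- rewrite (big_fsetD1 p) //= eqxx big1_seq ?addr0 // => u.
  by rewrite !inE => /andP[_ /andP[/negPf-> _]].
- rewrite (big_fsetD1 p) //= eqxx scale1r big1_seq ?addr0 // => u.
  by rewrite !inE => /andP[_ /andP[/negPf-> _]]; rewrite scale0r.
Qed.

Lemma affine_on_hull_ge {R : realType} (S : {fset plane R})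
    (f : plane R -> R) (m : R) :
  affine_on (hull S) f -> (forall p, p \in S -> m <= f p) ->
  forall x, hull S x -> m <= f x.
Proof.
move=> [a [b [c fE]]] fS x Sx; rewrite (fE _ Sx).
case: Sx => l [l0 l1 ->]; rewrite (affine_sum _ _ _ _ _ l1).
have -> : m = \sum_(p <- S) l p * m by rewrite -mulr_suml l1 mul1r.
rewrite !big_seq; apply: ler_sum => p pS; apply: ler_wpM2l; first exact: l0.
by rewrite -(fE _ (vertex_in_hull _ _ pS)) fS.
Qed.

Lemma affine_on_hull_bounds {R : realType} (S : {fset plane R})
    (f : plane R -> R) (m M : R) :
  affine_on (hull S) f -> (forall p, p \in S -> m <= f p <= M) ->
  forall x, hull S x -> m <= f x <= M.
Proof.
move=> aff fS x Sx; apply/andP; split.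
  by apply: (affine_on_hull_ge S) => // p /fS/andP[].
rewrite -lerN2; apply: (affine_on_hull_ge S (fun x => - f x)) => //.
  case: aff => [a [b [c fE]]]; exists (- a), (- b), (- c) => z /fE ->; ring.
by move=> p /fS/andP[_]; rewrite lerN2.
Qed.

(** The points [q i] may coincide: coefficients of equal points are added up. *)
Lemma hull_comb {R : realType} (S : {fset plane R}) (n : nat)
    (q : 'I_n -> plane R) (a : 'I_n -> R) :
  (forall i, q i \in S) -> (forall i, 0 <= a i) -> \sum_i a i = 1 ->
  hull S (\sum_i a i *: q i).
Proof.
move=> qS a0 a1; exists (fun u => \sum_i a i * (u == q i)%:R); split.
- by move=> u _; apply: sumr_ge0 => i _; rewrite mulr_ge0.
- rewrite exchange_big /= -[RHS]a1; apply: eq_bigr => i _.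
  rewrite (big_fsetD1 (q i)) //= eqxx /= mulr1 big1_seq ?addr0 // => u.
  by rewrite !inE => /andP[_ /andP[/negPf-> _]]; rewrite mulr0.
- under [RHS]eq_bigr do rewrite scaler_suml.
  rewrite exchange_big /=; apply: eq_bigr => i _.
  rewrite (big_fsetD1 (q i)) //= eqxx /= mulr1 big1_seq ?addr0 // => u.
  by rewrite !inE => /andP[_ /andP[/negPf-> _]]; rewrite mulr0 scale0r.
Qed.

Lemma hull_comb3 {R : realType} (S : {fset plane R}) (p q r : plane R)
    (a b c : R) : p \in S -> q \in S -> r \in S ->
  0 <= a -> 0 <= b -> 0 <= c -> a + b + c = 1 ->
  hull S (a *: p + b *: q + c *: r).
Proof.
move=> pS qS rS a0 b0 c0 abc.
have := hull_comb S 3 (fun i => [:: p; q; r]`_i) (fun i => [:: a; b; c]`_i).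
rewrite !big_ord_recl !big_ord0 /= !addr0 !addrA; apply=> //;
 by move=> [[|[|[|]]]].
Qed.

(** * Triangles *)

(** The form with a quotient covers barycentric coordinates, where [k] is the
    area of the whole triangle. *)
Lemma affine_signed_area {R : realType} (A : set (plane R)) (b c : plane R)
    (k : R) : affine_on A (fun x => signed_area x b c / k).
Proof.
exists ((b.2 - c.2) / 2 / k), ((c.1 - b.1) / 2 / k),
  ((b.1 * c.2 - c.1 * b.2) / 2 / k).
by move=> x _; rewrite /signed_area; ring.
Qed.

Lemma signed_area_rot {R : realType} (a b c : plane R) :
  signed_area a b c = signed_area b c a.
Proof. by rewrite /signed_area; ring. Qed.

(** Cramer's rule: the barycentric coordinates are the normalized areas of the
    three triangles that [x] spans with the edges. *)
Lemma barycentricE {R : realType} (a b c x : plane R) :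
  let D := signed_area a b c in D != 0 ->
  x = (signed_area x b c / D) *: a + (signed_area x c a / D) *: b +
      (signed_area x a b / D) *: c /\
  signed_area x b c / D + signed_area x c a / D + signed_area x a b / D = 1.
Proof.
move=> D D0; split; last first.
  rewrite -!mulrDl -[RHS](divff D0); congr (_ / _).
  by rewrite /D /signed_area; ring.
have E1 : D * x.1 = signed_area x b c * a.1 + signed_area x c a * b.1 +
  signed_area x a b * c.1 by rewrite /D /signed_area; ring.
have E2 : D * x.2 = signed_area x b c * a.2 + signed_area x c a * b.2 +
  signed_area x a b * c.2 by rewrite /D /signed_area; ring.
clearbody D; apply: plane_eq; rewrite /= !scale_real;
  apply: (mulfI D0); rewrite ?E1 ?E2; field; exact: D0.
Qed.

(** A barycentric coordinate is an affine function of [x], nonnegative at the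
    three vertices and hence on their hull. *)
Lemma hull_triangleP {R : realType} (a b c x : plane R) :
  let D := signed_area a b c in D != 0 ->
  hull [fset a; b; c]%fset x <->
  [/\ 0 <= signed_area x b c / D, 0 <= signed_area x c a / D
    & 0 <= signed_area x a b / D].
Proof.
move=> D D0; split.
- move=> Sx.
  have ge0 p q : (forall u, u \in [fset a; b; c]%fset ->
      0 <= signed_area u p q / D) -> 0 <= signed_area x p q / D.
    by move=> H; apply: (affine_on_hull_ge _ _ _ (affine_signed_area _ p q D) H).
  have AE : forall p q : plane R, (signed_area p p q = 0) * (signed_area p q p = 0).
    by move=> p q; rewrite /signed_area; split; ring.
  have D1 : 0 <= D / D by rewrite divff.
  split; apply: ge0 => u; rewrite !inE => /orP[/orP[]|] /eqP->;
    rewrite ?AE ?mul0r //.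
  + by rewrite -signed_area_rot.
  + by rewrite signed_area_rot.
- move=> [x0 y0 z0]; have [xE sum1] := barycentricE _ _ _ x D0.
  rewrite -/D in xE sum1; clearbody D; rewrite xE.
  by apply: hull_comb3; rewrite ?inE ?eqxx ?orbT.
Qed.

Lemma closed_hull_triangle {R : realType} (T : {fset plane R}) :
  is_triangle T -> closed (hull T).
Proof.
move=> [a [b [c [-> D0]]]].
have clos p q k : closed [set x : plane R | 0 <= signed_area x p q / k].
  apply: (@preimage_closed _ _ _ [set t : R | 0 <= t]); last exact: closed_ge.
  move=> x _.
  have [a1 [b1 [c1 E]]] := affine_signed_area setT p q k.
  rewrite (funext (fun x => E x I)).
  apply: cvgD; last exact: cvg_cst.
  by apply: cvgD; (apply: cvgM; first exact: cvg_cst); [exact: cvg_fst|exact: cvg_snd].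
have -> : hull [fset a; b; c]%fset =
    [set x | 0 <= signed_area x b c / signed_area a b c] `&`
    [set x | 0 <= signed_area x c a / signed_area a b c] `&`
    [set x | 0 <= signed_area x a b / signed_area a b c].
  apply/seteqP; split=> x /=.
    by move=> /(hull_triangleP _ _ _ _ D0)[].
  by move=> [[? ?] ?]; apply/(hull_triangleP _ _ _ _ D0).
by do !apply: closedI.
Qed.

(** Vertices of a triangle are extreme points: the normalized area with respect
    to the opposite edge vanishes at the other vertices, hence on their hull,
    but not at [v]. *)
Lemma triangle_extreme {R : realType} (S T : {fset plane R}) (v : plane R) :
  is_triangle T -> (S `<=` T)%fset -> v \in T -> hull S v -> v \in S.
Proof.
move=> [a [b [c [-> D0]]]] ST vT Sv; apply/negPn/negP => vS.
have [p [q [D1 pq]]] : exists p q, signed_area v p q != 0 /\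
    forall u, u \in S -> u = p \/ u = q.
  have uT u : u \in S -> (u != v) /\ [|| u == a, u == b | u == c].
    move=> uS; split; first by apply: contraNneq vS => <-.
    by have /= := fsubsetP ST u uS; rewrite !inE -orbA.
  move: vT; rewrite !inE -orbA => /or3P[] /eqP ev; subst v.
  - by exists b, c; split=> // u /uT[/negPf->] /= /orP[] /eqP; auto.
  - exists c, a; split; first by rewrite -signed_area_rot.
    by move=> u /uT[/negPf->] /orP[/eqP|/eqP]; auto.
  - exists a, b; split; first by rewrite signed_area_rot.
    by move=> u /uT[/negPf->]; rewrite orbF => /orP[/eqP|/eqP]; auto.
(* The normalizing sign is negative so that the value at [v] is -1. *)
have ge0 : 0 <= signed_area v p q / - signed_area v p q.
  apply: (affine_on_hull_ge _ _ _ (affine_signed_area _ p q _) _ _ Sv).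
  by move=> u /pq[]->; rewrite (_ : signed_area _ p q = 0) ?mul0r //;
     rewrite /signed_area; ring.
by move: ge0; rewrite invrN mulrN divff // oppr_ge0 ler10.
Qed.

(** * Neighbours of an interior vertex *)

(** A triangle whose hull contains [v] has [v] as a vertex, for its intersection
    with a triangle at [v] is spanned by common vertices and [v] is extreme.
    The other triangles are closed, so points [v + t *: n] with small [t > 0] lie
    in triangles at [v].  If no vertex of such a triangle were on the positive
    side of the line through [v] orthogonal to [n], neither would
    [v + t *: n]. *)
Lemma neighbour_in_direction {R : realType} (Omega : set (plane R)) (K : mesh R)
    (v n : plane R) : open Omega -> triangulation Omega K ->
  interior_vertex Omega K v -> n != 0 ->
  exists2 b, edge K v b & 0 < n.1 * (b.1 - v.1) + n.2 * (b.2 - v.2).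
Proof.
move=> oO [triK covK confK] [[T0 T0K vT0] Ov] n0.
have star T : T \in K -> hull T v -> v \in T.
  move=> TK Tv; have : hull (T `&` T0)%fset v.
    by rewrite -confK //; split=> //; exact: vertex_in_hull.
  move/(triangle_extreme _ _ _ (triK _ T0K) (fsubsetIr _ _) vT0).
  by rewrite inE => /andP[].
pose far := \bigcap_(T in [set` K]) [set x : plane R | hull T x -> v \in T].
have near_v : nbhs v (Omega `&` far).
  apply: filterI; first exact: open_nbhs_nbhs.
  apply: filter_bigI => T TK.
  have [vT|vT] := boolP (v \in T); first exact: filterE.
  have : nbhs v (~` hull T).
    apply: open_nbhs_nbhs; split; last by move=> /(star _ TK); apply/negP.
    by apply: closed_openC; apply: closed_hull_triangle; exact: triK.
  by apply: filterS => x Tx /Tx.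
have ray : (fun t : R => v + t *: n) @ 0 --> v.
  have {2}<- : v + 0 *: n = v by rewrite scale0r addr0.
  by apply: cvgD; [exact: cvg_cst | apply: cvgZr_tmp; exact: cvg_id].
have [t [t0 [Ot ft]]] : exists t : R, 0 < t /\ (Omega `&` far) (v + t *: n).
  have near0 : \forall t \near (0 : R), (Omega `&` far) (v + t *: n) := ray _ near_v.
  have near0' : \forall t \near (0 : R)^'+, (Omega `&` far) (v + t *: n).
    exact: cvg_within.
  near (0 : R)^'+ => t; exists t; split.
    by near: t; exact: nbhs_right_gt.
  by near: t.
have : closure Omega (v + t *: n) by exact: subset_closure.
rewrite covK => -[T TK Tx]; have vT := ft T TK Tx.
pose f (x : plane R) : R := n.1 * (x.1 - v.1) + n.2 * (x.2 - v.2).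
have nn : 0 < n.1 ^+ 2 + n.2 ^+ 2.
  rewrite lt_neqAle addr_ge0 ?sqr_ge0 // andbT eq_sym paddr_eq0 ?sqr_ge0 //.
  rewrite !sqrf_eq0; apply: contra n0 => /andP[/eqP e1 /eqP e2].
  by apply/eqP/plane_eq.
suff [b bT fb] : exists2 b, b \in T & 0 < f b.
  exists b => //; split; last by exists T.
  by apply: contraTneq fb => <-; rewrite /f !subrr !mulr0 addr0 ltxx.
apply: contrapT => noT.
have : 0 <= - f (v + t *: n).
  apply: (affine_on_hull_ge _ (fun x => - f x) _ _ _ _ Tx).
    exists (- n.1), (- n.2), (n.1 * v.1 + n.2 * v.2) => x _; rewrite /f; ring.
  move=> p pT; rewrite oppr_ge0 leNgt; apply/negP => fp; apply: noT.
  by exists p.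
rewrite oppr_ge0 leNgt => /negP; apply.
rewrite (_ : f _ = t * (n.1 ^+ 2 + n.2 ^+ 2)) ?mulr_gt0 //.
rewrite /f /= !scale_real; ring.
Unshelve. all: by end_near. Qed.

(** * Points in cyclic order *)

(** For directions listed in cyclic order, the counterclockwise angle from
    [theta i] to [theta j], positive and at most [2 * pi].  It is [2 * pi] if
    [i = j], so that a single point is a full turn away from its successor,
    which is itself. *)
Definition turn {R : realType} {s : nat} (theta : 'I_s -> R) (i j : 'I_s) : R :=
  theta j - theta i + (if (j <= i)%N then pi *+ 2 else 0).

Lemma sin_turn {R : realType} {s : nat} (theta : 'I_s -> R) (i j : 'I_s) :
  sin (turn theta i j) = sin (theta j - theta i).
Proof. by rewrite /turn; case: leqP => _; rewrite ?addr0 // sinD2pi. Qed.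

Lemma turn_gt0 {R : realType} {s : nat} (theta : 'I_s -> R) (i j : 'I_s) :
  (forall i j : 'I_s, (i < j)%N -> theta i < theta j) ->
  (forall i j, theta i < theta j + 2 * pi) -> 0 < turn theta i j.
Proof.
move=> mono wrap; rewrite /turn; case: leqP => ij.
  by have := wrap i j; lra.
by have := mono i j ij; lra.
Qed.

Lemma turn_lt2pi {R : realType} {s : nat} (theta : 'I_s -> R) (i j : 'I_s) :
  (forall i j : 'I_s, (i < j)%N -> theta i < theta j) ->
  (forall i j, theta i < theta j + 2 * pi) -> i != j ->
  turn theta i j < 2 * pi.
Proof.
move=> mono wrap nij; rewrite /turn; case: leqP => ij.
  have /mono : (j < i)%N by rewrite ltn_neqAle ij andbT eq_sym.
  lra.
by have := wrap j i; lra.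
Qed.

(** The successor of [i] is the first direction met when turning from [i]. *)
Lemma turn_ordS_lt {R : realType} {s : nat} (theta : 'I_s -> R) (i j : 'I_s) :
  (forall i j : 'I_s, (i < j)%N -> theta i < theta j) ->
  (forall i j, theta i < theta j + 2 * pi) -> j != ordS i ->
  turn theta i (ordS i) < turn theta i j.
Proof.
move=> mono wrap nj; have ns := ltn_ord i.
have {nj} : (j : nat) != ordS i by [].
rewrite /turn; have [iS|iS] := ltnP i.+1 s.
  have E : ordS i = i.+1 :> nat by rewrite /= modn_small.
  rewrite E ltnn; case: leqP => ij nj; first by have := wrap (ordS i) j; lra.
  have /mono : (ordS i < j)%N by rewrite E ltn_neqAle eq_sym nj.
  lra.
have E : ordS i = 0%N :> nat.
  by rewrite /= (_ : i.+1 = s) ?modnn //; apply/eqP; rewrite eqn_leq ns.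
rewrite E leq0n; have -> : (j <= i)%N by have := ltn_ord j; lia.
move=> nj; have /mono : (ordS i < j)%N by rewrite E lt0n.
lra.
Qed.

Lemma signed_area_polar {R : realType} (c : plane R) (r t r' t' : R) :
  signed_area c (c + r *: (cos t, sin t)) (c + r' *: (cos t', sin t')) =
  r * r' / 2 * sin (t' - t).
Proof. by rewrite /signed_area /= !scale_real sinB; ring. Qed.

(** Some [y j] is less than [pi] ahead of [y i], and [y (ordS i)] comes no later. *)
Lemma consecutive_area_gt0 {R : realType} {s : nat} (c : plane R)
    (y : 'I_s -> plane R) : cyclic_around c y ->
  (forall i, exists j, 0 < signed_area c (y i) (y j)) ->
  forall i, 0 < signed_area c (y i) (y (ordS i)).
Proof.
move=> [r [theta [r0 mono wrap yE]]] span i.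
have pos k : 0 < r i * r k / 2 by rewrite divr_gt0 ?mulr_gt0.
have [j] := span i; rewrite !yE !signed_area_polar !pmulr_rgt0 //.
rewrite -!sin_turn => sj.
apply: sin_gt0_pi; rewrite turn_gt0 //=.
have le_turn : turn theta i (ordS i) <= turn theta i j.
  have [->//|nj] := eqVneq j (ordS i).
  exact/ltW/turn_ordS_lt.
apply: le_lt_trans le_turn _; rewrite ltNge; apply/negP => jpi.
have [ij|nij] := eqVneq i j.
  by move: sj; rewrite sin_turn ij subrr sin0 ltxx.
have lt2 := turn_lt2pi theta i j mono wrap nij.
have : 0 <= sin (turn theta i j - pi).
  by apply: sin_ge0_pi; apply/andP; split; lra.
by move: sj; rewrite -{1}[turn theta i j](subrK pi) sinDpi; lra.
Qed.

(** A point [y i] in the sector from [y j] to [y (ordS j)] would be met before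
    the successor of [j]. *)
Lemma sector_empty {R : realType} {s : nat} (c : plane R)
    (y : 'I_s -> plane R) (i j : 'I_s) : cyclic_around c y ->
  0 < signed_area c (y j) (y (ordS j)) ->
  0 <= signed_area c (y j) (y i) ->
  0 <= signed_area c (y i) (y (ordS j)) -> i = j \/ i = ordS j.
Proof.
move=> [r [theta [r0 mono wrap yE]]].
have pos k l : 0 < r k * r l / 2 by rewrite divr_gt0 ?mulr_gt0.
rewrite !yE !signed_area_polar !pmulr_rgt0 // !pmulr_rge0 // => _.
rewrite -sin_turn => ji ij.
have [->|nij] := eqVneq i j; first by left.
have [->|nis] := eqVneq i (ordS j); first by right.
exfalso.
have lt1 := turn_ordS_lt theta j i mono wrap nis.
have lt2 : turn theta j i < 2 * pi by apply: turn_lt2pi => //; rewrite eq_sym.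
have gt0 := turn_gt0 theta j (ordS j) mono wrap.
have lepi : turn theta j i <= pi.
  rewrite leNgt; apply/negP => gtpi.
  have : 0 < sin (turn theta j i - pi).
    by apply: sin_gt0_pi; apply/andP; split; lra.
  by move: ji; rewrite -{1}[turn theta j i](subrK pi) sinDpi; lra.
have : 0 < sin (turn theta j i - turn theta j (ordS j)).
  by apply: sin_gt0_pi; apply/andP; split; lra.
rewrite -(opprB (turn theta j (ordS j))) sinN.
suff -> : sin (turn theta j (ordS j) - turn theta j i) =
    sin (theta (ordS j) - theta i) by lra.
rewrite /turn; case: leqP => _; case: leqP => _.
- by congr sin; ring.
- by rewrite -[RHS]sinD2pi; congr sin; ring.
- by rewrite -[LHS]sinD2pi; congr sin; ring.
- by congr sin; ring.
Qed.

(** If [z = y i] were a reflex corner, the chord from [p] to [q] would cross the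
    ray from [c] through [z] at a point [x = c + lam *: (z - c)] with [lam > 1].
    By convexity [x] lies in some triangle [c, y j, y (ordS j)].  The ray then
    runs in the sector of that triangle, so it is one of its two sides
    ([sector_empty]), and such a side ends at [z], before [x]. *)
Lemma convex_corner {R : realType} {s : nat} (c : plane R)
    (y : 'I_s -> plane R) (i : 'I_s) : cyclic_around c y ->
  (forall i, 0 < signed_area c (y i) (y (ordS i))) -> convex_polygon c y ->
  0 <= signed_area (y (ord_pred i)) (y i) (y (ordS i)).
Proof.
move=> cyc pos conv; rewrite leNgt; apply/negP => neg.
set p := y (ord_pred i) in neg *; set q := y (ordS i) in neg *.
set z := y i in neg *.
have A0 : 0 < signed_area c p z by have := pos (ord_pred i); rewrite ord_predK.
have B0 : 0 < signed_area c z q by exact: pos.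
set A := signed_area c p z in A0; set B := signed_area c z q in B0.
pose C := signed_area c p q.
have CE : signed_area p z q = A + B - C.
  by rewrite /A /B /C /signed_area; ring.
have AB0 : A + B != 0 by lra.
pose lam := C / (A + B).
have lam1 : 1 < lam by rewrite /lam ltr_pdivlMr; lra.
pose x := c + lam *: (z - c).
have t0 : 0 <= B / (A + B) by rewrite divr_ge0; lra.
have t1 : B / (A + B) <= 1 by rewrite ler_pdivrMr; lra.
have inP j : polygon c y (y j).
  by exists j => //; apply: vertex_in_hull; rewrite !inE eqxx orbT.
(* The crossing point divides the chord in the ratio of the areas [A], [B]. *)
have xE : x = (B / (A + B)) *: p + (1 - B / (A + B)) *: q.
  have E1 : (A + B) * (c.1 + lam * (z.1 - c.1)) = B * p.1 + A * q.1.
    transitivity ((A + B) * c.1 + C * (z.1 - c.1)); first by rewrite /lam; field.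
    by rewrite /A /B /C /signed_area; ring.
  have E2 : (A + B) * (c.2 + lam * (z.2 - c.2)) = B * p.2 + A * q.2.
    transitivity ((A + B) * c.2 + C * (z.2 - c.2)); first by rewrite /lam; field.
    by rewrite /A /B /C /signed_area; ring.
  by apply: plane_eq; rewrite /x /= !scale_real; apply: (mulfI AB0);
    rewrite ?E1 ?E2; field.
have : polygon c y x.
  have := conv p q (Itv01 t0 t1) (mem_set (inP _)) (mem_set (inP _)).
  by rewrite inE xE.
move=> [j _].
have Dj := lt0r_neq0 (pos j).
have Dinv : 0 < (signed_area c (y j) (y (ordS j)))^-1 by rewrite invr_gt0.
move=> /(hull_triangleP _ _ _ _ Dj)[].
rewrite !(pmulr_lge0 _ Dinv) => h1 h2 h3.
have lam0 : 0 < lam by lra.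
have F2 : signed_area x (y (ordS j)) c = lam * signed_area c z (y (ordS j)).
  by rewrite /x /signed_area /= !scale_real; ring.
have F3 : signed_area x c (y j) = lam * signed_area c (y j) z.
  by rewrite /x /signed_area /= !scale_real; ring.
rewrite F2 pmulr_rge0 // in h2; rewrite F3 pmulr_rge0 // in h3.
have ij := sector_empty c y i j cyc (pos j) h3 h2.
have : signed_area x (y j) (y (ordS j)) = (1 - lam) * signed_area c (y j) (y (ordS j)).
  rewrite /x /z; case: ij => ->; rewrite /signed_area /= !scale_real; ring.
by move=> E; move: h1; rewrite E leNgt nmulr_rlt0 ?pos //; lra.
Qed.

(** A flat corner makes [z = y i] a proper convex combination of its two
    neighbours [p] and [q], with weights proportional to the positive areas [B]
    and [A].  By strict convexity of the squared distance to [c], this is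
    impossible when [z] is at maximal distance, unless [p = z]; but then the
    triangle [c, p, z] has area zero. *)
Lemma farthest_corner {R : realType} {s : nat} (c : plane R)
    (y : 'I_s -> plane R) : (0 < s)%N ->
  (forall i, 0 < signed_area c (y i) (y (ordS i))) ->
  (forall i, 0 <= signed_area (y (ord_pred i)) (y i) (y (ordS i))) ->
  exists i, 0 < signed_area (y (ord_pred i)) (y i) (y (ordS i)).
Proof.
move=> s0 pos cvx.
pose d (p : plane R) := (p.1 - c.1) ^+ 2 + (p.2 - c.2) ^+ 2.
have [i _ imax] := @arg_maxP _ _ _ (Ordinal s0) predT (fun i => d (y i)) isT.
exists i; rewrite lt_neqAle cvx andbT eq_sym; apply/eqP.
have := imax (ord_pred i) isT; have := imax (ordS i) isT.
have := pos (ord_pred i); rewrite ord_predK; have := pos i.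
rewrite /d; move: (y (ord_pred i)) (y i) (y (ordS i)) => p z q /=.
set A := signed_area c p z; set B := signed_area c z q => B0 A0 dq dp E.
have E1 : B * (p.1 - z.1) = - A * (q.1 - z.1).
  apply/eqP; rewrite -subr_eq0; apply/eqP.
  transitivity (signed_area p z q * (c.1 - z.1)); last by rewrite E mul0r.
  by rewrite /A /B /signed_area; ring.
have E2 : B * (p.2 - z.2) = - A * (q.2 - z.2).
  apply/eqP; rewrite -subr_eq0; apply/eqP.
  transitivity (signed_area p z q * (c.2 - z.2)); last by rewrite E mul0r.
  by rewrite /A /B /signed_area; ring.
pose n (u w : plane R) := (u.1 - w.1) ^+ 2 + (u.2 - w.2) ^+ 2.
(* The parallel axis identity for the weighted mean [z] of [p] and [q]. *)
have S : B * (n p c - n z c) + A * (n q c - n z c) = B * n p z + A * n q z.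
  transitivity (B * n p z + A * n q z
    + 2 * ((B * (p.1 - z.1) + A * (q.1 - z.1)) * (z.1 - c.1)
         + (B * (p.2 - z.2) + A * (q.2 - z.2)) * (z.2 - c.2))).
    by rewrite /n; ring.
  by rewrite E1 E2; ring.
have n0 u w : 0 <= n u w by rewrite addr_ge0 ?sqr_ge0.
have pz : n p z = 0.
  have := n0 p z; have := n0 q z; rewrite -/(n _ _) in dp dq.
  move=> ? ?; apply/eqP; rewrite eq_le n0 andbT -(pmulr_rle0 _ B0).
  have : B * (n p c - n z c) <= 0 by rewrite pmulr_rle0 // subr_le0.
  have : A * (n q c - n z c) <= 0 by rewrite pmulr_rle0 // subr_le0.
  have : 0 <= A * n q z by rewrite pmulr_rge0.
  lra.
move/eqP: pz; rewrite paddr_eq0 ?sqr_ge0 // !sqrf_eq0 !subr_eq0 => /andP[/eqP e1 /eqP e2].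
by move: A0; rewrite /A (plane_eq p z) // (_ : signed_area c z z = 0) ?ltxx // /signed_area; ring.
Qed.

(** * Wachspress coordinates *)

Lemma wachspress_convex_weights {R : realType} {s : nat} (c : plane R)
    (y : 'I_s -> plane R) : (0 < s)%N -> cyclic_around c y ->
  convex_polygon c y -> (forall i, exists j, 0 < signed_area c (y i) (y j)) ->
  (forall i, 0 <= wachspress y c i) /\ \sum_i wachspress y c i = 1.
Proof.
move=> s0 cyc conv span.
have pos := consecutive_area_gt0 c y cyc span.
have cvx i := convex_corner c y i cyc pos conv.
have den i : 0 < signed_area c (y (ord_pred i)) (y i) *
    signed_area c (y i) (y (ordS i)).
  by rewrite mulr_gt0 //; have := pos (ord_pred i); rewrite ord_predK.
have w0 i : 0 <= wachspress_weight y c i by rewrite divr_ge0 // ltW.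
have sum_gt0 : 0 < \sum_j wachspress_weight y c j.
  have [i strict] := farthest_corner c y s0 pos cvx.
  rewrite (bigD1 i) //=; apply: ltr_pwDl; first exact: divr_gt0.
  exact: sumr_ge0.
split=> [i|]; first by rewrite divr_ge0 // ltW.
by rewrite -mulr_suml divff // gt_eqF.
Qed.

(** * The refined mesh *)

Lemma in_medial {R : realType} (T : {fset plane R}) (a b : plane R) :
  a \in T -> b \in T -> a != b -> midpoint a b \in medial T.
Proof.
move=> aT bT ab; apply/imfset2P; exists a => //; exists b => //=.
by rewrite inE bT.
Qed.

Lemma in_corner {R : realType} (T : {fset plane R}) (a b : plane R) :
  b \in T -> midpoint a b \in corner T a.
Proof. by move=> bT; apply/imfsetP; exists b. Qed.

Lemma midpointxx {R : realType} (a : plane R) : midpoint a a = a.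
Proof. by apply: plane_eq; rewrite /midpoint /= !scale_real; field. Qed.

(** The degenerate midpoints, with [a = b], are the vertices of the [h]-mesh. *)
Lemma half_mesh_vertex {R : realType} (K : mesh R) (S : {fset plane R})
    (p : plane R) : half_mesh K S -> p \in S ->
  exists T a b, [/\ T \in K, a \in T, b \in T & p = midpoint a b].
Proof.
move=> [T TK [->|[a aT ->]]].
  move=> /imfset2P[a aT [b]]; rewrite inE => /andP[bT _] ->.
  by exists T, a, b.
by move=> /imfsetP[b /= bT ->]; exists T, a, b.
Qed.

Lemma midpoint_in_hull {R : realType} (T : {fset plane R}) (a b : plane R) :
  a \in T -> b \in T -> hull T (midpoint a b).
Proof.
move=> aT bT.
have -> : midpoint a b = 2^-1 *: a + 2^-1 *: b + 0 *: b.
  by rewrite /midpoint scale0r addr0 scalerDr.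
apply: hull_comb3 => //; lra.
Qed.

(** A point with a barycentric coordinate at least 1/2 lies in the corner
    triangle at that vertex; if all coordinates are less than 1/2, it lies in
    the medial triangle. *)
Lemma half_mesh_cover {R : realType} (K : mesh R) (T : {fset plane R})
    (x : plane R) : is_triangle T -> T \in K -> hull T x ->
  exists2 S, half_mesh K S & hull S x.
Proof.
move=> [a [b [c [TE D0]]]] TK; rewrite TE => /(hull_triangleP _ _ _ _ D0).
set D := signed_area a b c in D0 *.
have [xE sum1] := barycentricE _ _ _ x D0; rewrite -/D in xE sum1.
move: sum1 xE; move: (signed_area x b c / D) (signed_area x c a / D)
  (signed_area x a b / D) => al be ga sum1 xE [al0 be0 ga0].
have [aT bT cT] : [/\ a \in T, b \in T & c \in T].
  by rewrite TE !inE !eqxx ?orbT.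
(* Stated for any order of the vertices, to be used at each of the three. *)
have cornerP (u v w : plane R) (k l m : R) : u \in T -> v \in T -> w \in T -> 
  2^-1 <= k -> 0 <= l -> 0 <= m -> k + l + m = 1 ->
  x = k *: u + l *: v + m *: w -> exists2 S, half_mesh K S & hull S x.
  move=> uT vT wT k2 l0 m0 klm xE'.
  exists (corner T u); first by exists T => //; right; exists u.
  have -> : x = (2 * k - 1) *: midpoint u u + (2 * l) *: midpoint u v +
      (2 * m) *: midpoint u w.
    have kE : k = 1 - l - m by lra.
    by rewrite xE' kE; apply: plane_eq; rewrite /midpoint /= !scale_real; field.
  by apply: hull_comb3; rewrite ?in_corner //; lra.
have [la|la] := lerP 2^-1 al; first exact: (cornerP a b c al be ga).
have [lb|lb] := lerP 2^-1 be.
  apply: (cornerP b a c be al ga) => //; first by rewrite (addrC be).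
  by rewrite (addrC (be *: b)).
have [lc|lc] := lerP 2^-1 ga.
  apply: (cornerP c a b ga al be) => //; first by rewrite -addrA addrC.
  by rewrite -addrA addrC.
have [ab bc ca] : [/\ a != b, b != c & c != a].
  split; apply: contra_neq D0 => E; rewrite /D E /signed_area; ring.
exists (medial T); first by exists T => //; left.
have -> : x = (1 - 2 * ga) *: midpoint a b + (1 - 2 * al) *: midpoint b c +
    (1 - 2 * be) *: midpoint c a.
  have alE : al = 1 - be - ga by lra.
  by rewrite xE alE; apply: plane_eq; rewrite /midpoint /= !scale_real; field.
by apply: hull_comb3; rewrite ?in_medial //; lra.
Qed.

(** * Values at the vertices of the refined mesh *)

Lemma weighted_average_bounds {R : realType} {s : nat} (l f : 'I_s -> R)
    (m M : R) : (forall i, 0 <= l i) -> \sum_i l i = 1 ->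
  (forall i, m <= f i <= M) -> m <= \sum_i l i * f i <= M.
Proof.
move=> l0 l1 fb.
have -> : m = \sum_i l i * m by rewrite -mulr_suml l1 mul1r.
have -> : M = \sum_i l i * M by rewrite -mulr_suml l1 mul1r.
by apply/andP; split; apply: ler_sum => i _; apply: ler_wpM2l => //;
  case/andP: (fb i).
Qed.

Lemma cr_midpoint_value {R : realType} (Omega : set (plane R)) (K : mesh R)
    (N : nat) (x : 'I_N -> plane R) (phi : 'I_N -> piecewise R)
    (U : 'I_N -> R) (uh : piecewise R) (T : {fset plane R}) (a b : plane R) :
  set_bij setT (edge_midpoints K) x -> crouzeix_raviart_basis Omega K x phi ->
  pw_eq K uh (pw_comb U phi) ->
  T \in K -> a \in T -> b \in T -> a != b ->
  exists i, uh T (midpoint a b) = U i.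
Proof.
move=> [_ _ surj] [_ _ nodal] hU TK aT bT ab.
have [j _ xj] : exists2 j, setT j & x j = midpoint a b.
  by apply: surj; exists a, b; split=> //; split=> //; exists T.
exists j; rewrite hU //; last exact: midpoint_in_hull.
rewrite /pw_comb (bigD1 j) //= -xj nodal //; last by rewrite xj in_medial.
rewrite eqxx mulr1 big1 ?addr0 // => i /negPf ij.
by rewrite nodal ?ij ?mulr0 // xj in_medial.
Qed.

(** [neighbour_in_direction], applied to the direction orthogonal to that of
    [y i], counterclockwise from it. *)
Lemma interior_vertex_span {R : realType} (Omega : set (plane R)) (K : mesh R)
    (v : plane R) (s : nat) (y : 'I_s -> plane R) :
  open Omega -> triangulation Omega K -> interior_vertex Omega K v ->
  set_bij setT (neighbours K v) y -> cyclic_around v y ->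
  (0 < s)%N /\ forall i, exists j, 0 < signed_area v (y i) (y j).
Proof.
move=> oO triK iv [_ _ surj] [r [theta [r0 _ _ yE]]].
have index b : edge K v b -> exists j, y j = midpoint v b.
  by move=> vb; have [|j _ yj] := surj (midpoint v b); [exists b|exists j].
split.
  have [|b /index[j _] _] := neighbour_in_direction _ _ v (1, 0) oO triK iv.
    by apply: contraTneq (@oner_neq0 R) => -[->]; rewrite eqxx.
  exact: leq_ltn_trans (ltn_ord j).
move=> i; pose d := y i - v.
have d0 : (- d.2, d.1) != 0.
  have dE : d = r i *: (cos (theta i), sin (theta i)) by rewrite /d yE addrC addKr.
  rewrite dE; apply/eqP => -[] /= /eqP; rewrite !scale_real.
  rewrite oppr_eq0 !mulf_eq0 gt_eqF //= => /eqP s0 /eqP.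
  rewrite mulf_eq0 gt_eqF //= => /eqP c0.
  by have := cos2Dsin2 (theta i); rewrite s0 c0 !expr0n addr0 => /esym/eqP; rewrite oner_eq0.
have [b /index[j yj] vb] := neighbour_in_direction _ _ v _ oO triK iv d0.
exists j; rewrite yj.
rewrite (_ : signed_area _ _ _ = ((- d.2) * (b.1 - v.1) + d.1 * (b.2 - v.2)) / 4).
  by rewrite divr_gt0.
by rewrite /d /signed_area /midpoint /= !scale_real; field.
Qed.

Theorem theorem5p2 (R : realType)
    (Omega : set (plane R)) (K : mesh R)
    (hOmega : bounded_domain Omega) (hK : triangulation Omega K)
    (N : nat) (x : 'I_N -> plane R) (hx : set_bij setT (edge_midpoints K) x)
    (phi : 'I_N -> piecewise R) (hphi : crouzeix_raviart_basis Omega K x phi)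
    (s : plane R -> nat) (y : forall v, 'I_(s v) -> plane R)
    (hy : neighbour_enumeration Omega K y)
    (hconv : forall v, interior_vertex Omega K v -> convex_polygon v (y v))
    (U : 'I_N -> R) (uh : piecewise R)
    (huh : crouzeix_raviart Omega K uh) (hU : pw_eq K uh (pw_comb U phi))
    (umin umax : R) (hUbnd : forall i, umin <= U i <= umax)
    (g : plane R -> R)
    (hg : forall p, boundary Omega p -> umin <= g p <= umax)
    (w : plane R -> R) (hw : wachspress_reconstruction Omega K y uh g w) :
  forall p, Omega p -> umin <= w p <= umax.
Proof.
move=> p Op.
have [oO _ _ _ _] := hOmega; have [triK covK _] := hK.
have [[_ affw] w_mid w_vertex w_bdry] := hw.
have uh_mid T a b : T \in K -> a \in T -> b \in T -> a != b ->
    umin <= uh T (midpoint a b) <= umax.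
  move=> TK aT bT ab.
  by have [i ->] := cr_midpoint_value _ _ _ _ _ _ _ _ _ _ hx hphi hU TK aT bT ab.
have [T TK Tp] : (\bigcup_(T in [set` K]) hull T)%classic p.
  by rewrite -covK; exact: subset_closure.
have [S KS Sp] := half_mesh_cover _ _ _ (triK _ TK) TK Tp.
apply: (affine_on_hull_bounds _ _ _ _ (affw _ KS) _ _ Sp) => q qS {T TK Tp p Op Sp}.
have [T [a [b [TK aT bT qE]]]] := half_mesh_vertex _ _ _ KS qS.
have cl_q : closure Omega q.
  by rewrite covK; exists T => //; rewrite qE; exact: midpoint_in_hull.
have [Oq|nOq] := pselect (Omega q); last first.
  have bq : boundary Omega q by [].
  by rewrite w_bdry //; [exact: hg | exists S].
have [ab|ab] := eqVneq a b; last first.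
  rewrite qE (w_mid a b T) //; first exact: uh_mid.
  split; first by split=> //; exists T.
  move=> /(_ q)[|_]; last by [].
  by rewrite qE; apply: midpoint_in_hull; rewrite !inE eqxx ?orbT.
have {qE ab} qE : q = a by rewrite qE -ab midpointxx.
subst q; have iv : interior_vertex Omega K a by split=> //; exists T.
have [bij cyc] := hy a iv.
have [s0 span] := interior_vertex_span _ _ _ _ _ oO hK iv bij cyc.
have [l0 l1] := wachspress_convex_weights a (y a) s0 cyc (hconv a iv) span.
have nbr j : exists T' c, [/\ T' \in K, a \in T', c \in T', a != c &
    y a j = midpoint a c].
  have [/(_ j I)[c [ac [T' [? ? ?]]] E] _ _] := bij.
  by exists T', c.
have [T' nbrT'] := choice nbr.
rewrite (w_vertex a iv T'); last first.
  move=> j; have [c [? ? ? ? ->]] := nbrT' j; split=> //; exact: in_medial.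
apply: weighted_average_bounds => // j.
by have [c [? ? ? ? ->]] := nbrT' j; apply: uh_mid.
Qed.
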